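(* For every compact Hausdorff space $X$, the multiplication map $\mu_{OH}X:OH(OH(X))\to OH(X)$ is open.
   Context: For a compactum $X$, $OH(X)$ is the subspace of $\prod_{\varphi\in C(X)}[\min\varphi,\max\varphi]$ (product topology) consisting of functionals $\nu:C(X)\to\mathbb{R}$ that are normed ($\nu(1_X)=1$), weakly additive ($\nu(\varphi+c_X)=\nu(\varphi)+c$ for constants $c$), order-preserving ($\varphi\le\psi\Rightarrow\nu(\varphi)\le\nu(\psi)$) and positively homogeneous ($\nu(t\varphi)=t\nu(\varphi)$, $t\ge0$). The multiplication $\mu_{OH}X:OH(OH(X))\to OH(X)$ is $\mu_{OH}X(\nu)(\varphi)=\nu(\pi_\varphi)$, where $\pi_\varphi:OH(X)\to\mathbb{R}$, $\pi_\varphi(\lambda)=\lambda(\varphi)$. *)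

(* Defs.v *)
From Stdlib Require Import Reals Lra List.
Open Scope R_scope.

Record Space := mkSpace {
  carrier :> Type;
  is_open : (carrier -> Prop) -> Prop
}.

(* The topology axioms (the empty set is the union of the empty family). *)
Definition is_topology (X : Space) : Prop :=
  is_open X (fun _ => True) /\
  (forall U V, is_open X U -> is_open X V -> is_open X (fun x => U x /\ V x)) /\
  (forall (I : Type) (U : I -> X -> Prop),
      (forall i, is_open X (U i)) -> is_open X (fun x => exists i, U i x)).

Definition is_compact (X : Space) : Prop :=
  forall (I : Type) (U : I -> X -> Prop),
    (forall i, is_open X (U i)) -> (forall x, exists i, U i x) ->
    exists l : list I, forall x, exists i, In i l /\ U i x.

Definition is_hausdorff (X : Space) : Prop :=
  forall x y : X, x <> y ->
    exists U V, is_open X U /\ is_open X V /\ U x /\ V y /\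
                (forall z, ~ (U z /\ V z)).

Definition continuous_R (X : Space) (f : X -> R) : Prop :=
  forall U : R -> Prop, open_set U -> is_open X (fun x => U (f x)).

Definition C (X : Space) : Type := { f : X -> R | continuous_R X f }.

Definition cf {X : Space} (f : C X) : X -> R := proj1_sig f.

Definition normed {X : Space} (nu : C X -> R) : Prop :=
  forall phi : C X, (forall x, cf phi x = 1) -> nu phi = 1.

Definition weakly_additive {X : Space} (nu : C X -> R) : Prop :=
  forall (phi psi : C X) (c : R), (forall x, cf psi x = cf phi x + c) ->
    nu psi = nu phi + c.

Definition order_preserving {X : Space} (nu : C X -> R) : Prop :=
  forall phi psi : C X, (forall x, cf phi x <= cf psi x) -> nu phi <= nu psi.

Definition pos_homogeneous {X : Space} (nu : C X -> R) : Prop :=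
  forall (phi psi : C X) (t : R), 0 <= t -> (forall x, cf psi x = t * cf phi x) ->
    nu psi = t * nu phi.

Definition is_OH {X : Space} (nu : C X -> R) : Prop :=
  normed nu /\ weakly_additive nu /\ order_preserving nu /\ pos_homogeneous nu.

Definition OH_carrier (X : Space) : Type := { nu : C X -> R | is_OH nu }.

Definition ev {X : Space} (nu : OH_carrier X) : C X -> R := proj1_sig nu.

(* Product (pointwise convergence) topology restricted to OH(X): W is open iff
   around each of its points it contains a basic neighbourhood
   {lambda | |lambda(phi_i) - nu(phi_i)| < eps, i = 1..n}. *)
Definition OH_open (X : Space) (W : OH_carrier X -> Prop) : Prop :=
  forall nu, W nu -> exists (l : list (C X)) (eps : R), 0 < eps /\
    forall lam : OH_carrier X,
      (forall phi, In phi l -> Rabs (ev lam phi - ev nu phi) < eps) -> W lam.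

Definition OH (X : Space) : Space := mkSpace (OH_carrier X) (OH_open X).

Lemma pi_continuous (X : Space) (phi : C X) :
  continuous_R (OH X) (fun lam : OH_carrier X => ev lam phi).
Proof.
  intros U HU nu Hnu.
  destruct (HU _ Hnu) as [[e he] Hd].
  exists (phi :: nil), e. split; [exact he|].
  intros lam Hl. apply Hd. unfold disc. simpl.
  apply Hl. left. reflexivity.
Qed.

Definition pi {X : Space} (phi : C X) : C (OH X) :=
  exist _ (fun lam : OH_carrier X => ev lam phi) (pi_continuous X phi).

Lemma mu_is_OH (X : Space) (nu : OH_carrier (OH X)) :
  is_OH (fun phi : C X => ev nu (pi phi)).
Proof.
  destruct nu as [nu [Hn [Ha [Ho Hh]]]]; simpl.
  repeat split.
  - intros phi H. apply Hn. intros lam. simpl.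
    apply (proj1 (proj2_sig lam)). exact H.
  - intros phi psi c H. apply Ha. intros lam. simpl.
    apply (proj1 (proj2 (proj2_sig lam))). exact H.
  - intros phi psi H. apply Ho. intros lam. simpl.
    apply (proj1 (proj2 (proj2 (proj2_sig lam)))). exact H.
  - intros phi psi t Ht H. apply Hh; [exact Ht|]. intros lam. simpl.
    apply (proj2 (proj2 (proj2 (proj2_sig lam)))); assumption.
Qed.

Definition mu_OH (X : Space) (nu : OH_carrier (OH X)) : OH_carrier X :=
  exist _ (fun phi : C X => ev nu (pi phi)) (mu_is_OH X nu).

Definition open_map (X Y : Space) (f : X -> Y) : Prop :=
  forall W : X -> Prop, is_open X W ->
    is_open Y (fun y => exists x, W x /\ f x = y).

(* Main.v *)
From Stdlib Require Import Reals Lra List.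
From Stdlib Require Import Classical FunctionalExtensionality PropExtensionality
  ProofIrrelevance.
From mathcomp Require filter.
Require Import Defs.

(** Given [nu], the functionals [N] with [mu N = nu] have a least element
    [L Phi = sup {nu phi | pi phi <= Phi}] and a greatest element
    [U Phi = inf {nu phi | Phi <= pi phi}].  If [mu N0 = nu0] and [nu] is close
    to [nu0], then [max L (min N0 U)] lies over [nu], and it is close to [N0] at
    [Phi] as soon as [L Phi < N0 Phi + eps] and [U Phi > N0 Phi - eps].  Since
    [N0] respects the bounds imposed by [nu0], it is enough that [U Phi] (and
    dually [L Phi]) be controlled by finitely many values of [nu]: there must be
    finitely many [psi] with [Phi - eps <= pi psi] such that every [phi] with
    [Phi <= pi phi] dominates one of them.

    Near a point [lam], [Phi] depends up to [eps] on the values at finitely many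
    [f].  Testing [Phi <= pi phi] on the least functional whose values at the [f]
    are [lam f - d] shows that [phi] dominates one of the functions
    [t (f - lam f) + Phi lam - eps], where the slope [t] may be bounded because
    [phi] is bounded below, and then discretized.  Compactness of [OH X] leaves
    finitely many points [lam]; the [psi] are the maxima of one such function for
    each of them. *)

(** * Continuous functions *)

Lemma is_open_ext (X : Space) (U V : X -> Prop) :
  (forall x, U x <-> V x) -> is_open X U -> is_open X V.
Proof.
  intros H HU. replace V with U; [exact HU|].
  apply functional_extensionality; intros x.
  apply propositional_extensionality, H.
Qed.

Lemma is_open_of_nbhds (X : Space) (HX : is_topology X) (U : X -> Prop) :
  (forall x, U x -> exists V, is_open X V /\ V x /\ forall y, V y -> U y) ->
  is_open X U.
Proof.
  intros H.
  apply (is_open_ext X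
    (fun x => exists i : {V : X -> Prop | is_open X V /\ forall y, V y -> U y},
       proj1_sig i x)).
  - intros x; split.
    + intros [[V [HV HVU]] Hx]; exact (HVU x Hx).
    + intros Hx. destruct (H x Hx) as [V [HV [HVx HVU]]].
      exists (exist _ V (conj HV HVU)); exact HVx.
  - apply (proj2 (proj2 HX)). intros [V [HV HVU]]; exact HV.
Qed.

Lemma open_set_ball (a e : R) : open_set (fun r => Rabs (r - a) < e).
Proof.
  intros r Hr. assert (H : 0 < e - Rabs (r - a)) by lra.
  exists (mkposreal _ H). intros s Hs. unfold disc in Hs; simpl in Hs.
  replace (s - a) with ((s - r) + (r - a)) by ring.
  eapply Rle_lt_trans; [apply Rabs_triang|lra].
Qed.

(** The [d]-ball conditions on [f] and [g] cut out an open set that maps into [U]. Affine images and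
    maxima are both instances, the former with a dummy second argument. *)
Lemma continuous_R_lift2 (X : Space) (HX : is_topology X) (F : R -> R -> R)
  (HF : forall a b e, 0 < e -> exists d, 0 < d /\ forall a' b',
      Rabs (a' - a) < d -> Rabs (b' - b) < d -> Rabs (F a' b' - F a b) < e)
  (f g : C X) :
  continuous_R X (fun x => F (cf f x) (cf g x)).
Proof.
  intros U HU. apply is_open_of_nbhds; [exact HX|].
  intros x Hx. destruct (HU _ Hx) as [[e He] Hd].
  destruct (HF (cf f x) (cf g x) e He) as [d [Hd0 Hd1]].
  exists (fun y => Rabs (cf f y - cf f x) < d /\ Rabs (cf g y - cf g x) < d).
  split; [|split].
  - apply (proj1 (proj2 HX)).
    + apply (proj2_sig f (fun r => Rabs (r - cf f x) < d)), open_set_ball.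
    + apply (proj2_sig g (fun r => Rabs (r - cf g x) < d)), open_set_ball.
  - split; rewrite Rminus_diag, Rabs_R0; exact Hd0.
  - intros y [Hf Hg]. apply Hd. unfold disc; simpl. apply Hd1; assumption.
Qed.

Lemma continuous_R_const (X : Space) (HX : is_topology X) (c : R) :
  continuous_R X (fun _ => c).
Proof.
  intros U HU. apply is_open_of_nbhds; [exact HX|].
  intros x Hx. exists (fun _ => True). split; [apply HX|]. now split.
Qed.

Lemma continuous_R_affine (X : Space) (HX : is_topology X) (t c : R) (f : C X) :
  continuous_R X (fun x => t * cf f x + c).
Proof.
  refine (continuous_R_lift2 X HX (fun a _ => t * a + c) _ f f).
  intros a b e He. pose proof (Rabs_pos t) as Ht.
  exists (e / (Rabs t + 1)). split.
  - apply Rdiv_lt_0_compat; lra.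
  - intros a' b' Ha _. replace (t * a' + c - (t * a + c)) with (t * (a' - a)) by ring.
    rewrite Rabs_mult. pose proof (Rabs_pos (a' - a)) as Hp.
    apply (Rmult_lt_compat_r (Rabs t + 1)) in Ha; [|lra].
    unfold Rdiv in Ha. rewrite Rmult_assoc, Rinv_l in Ha; [|lra]. nra.
Qed.

Lemma continuous_R_max (X : Space) (HX : is_topology X) (f g : C X) :
  continuous_R X (fun x => Rmax (cf f x) (cf g x)).
Proof.
  apply (continuous_R_lift2 X HX Rmax).
  intros a b e He. exists e. split; [exact He|].
  intros a' b' Ha Hb. apply Rabs_def2 in Ha. apply Rabs_def2 in Hb.
  apply Rabs_def1; unfold Rmax; destruct (Rle_dec a' b'), (Rle_dec a b); lra.
Qed.

Definition const_C {X : Space} (HX : is_topology X) (c : R) : C X :=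
  exist _ _ (continuous_R_const X HX c).

Definition affine_C {X : Space} (HX : is_topology X) (t c : R) (f : C X) : C X :=
  exist _ _ (continuous_R_affine X HX t c f).

Definition max_C {X : Space} (HX : is_topology X) (f g : C X) : C X :=
  exist _ _ (continuous_R_max X HX f g).

Lemma compact_C_bounded (X : Space) (Hc : is_compact X) (f : C X) :
  exists M, forall x, - M <= cf f x <= M.
Proof.
  destruct (Hc R (fun r x => Rabs (cf f x - 0) < r)) as [l Hl].
  - intros r. apply (proj2_sig f (fun s => Rabs (s - 0) < r)), open_set_ball.
  - intros x. exists (Rabs (cf f x - 0) + 1). lra.
  - exists (fold_right Rmax 0 l). intros x. destruct (Hl x) as [r [Hr Hx]].
    rewrite Rminus_0_r in Hx. apply Rabs_def2 in Hx.
    enough (r <= fold_right Rmax 0 l) by lra.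
    clear Hl Hx. induction l as [|s l IH]; simpl in *; [tauto|].
    destruct Hr as [->|Hr]; [apply Rmax_l|].
    eapply Rle_trans; [exact (IH Hr)|apply Rmax_r].
Qed.

(** * Functionals in [OH] *)

Section Functionals.
Context {X : Space}.
Implicit Types nu : C X -> R.

Lemma OH_ext nu (H : is_OH nu) (f g : C X) :
  (forall x, cf f x = cf g x) -> nu f = nu g.
Proof.
  destruct H as [_ [_ [Ho _]]]. intros E.
  apply Rle_antisym; apply Ho; intros x; rewrite E; apply Rle_refl.
Qed.

Lemma OH_affine (HX : is_topology X) nu (H : is_OH nu) (t c : R) (f g : C X) :
  0 <= t -> (forall x, cf g x = t * cf f x + c) -> nu g = t * nu f + c.
Proof.
  destruct H as [_ [Ha [_ Hh]]]. intros Ht E.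
  rewrite (Ha (affine_C HX t 0 f) g c).
  - rewrite (Hh f (affine_C HX t 0 f) t Ht); [reflexivity|].
    intros x; simpl; ring.
  - intros x; rewrite E; simpl; ring.
Qed.

Lemma OH_const (HX : is_topology X) nu (H : is_OH nu) (c : R) :
  nu (const_C HX c) = c.
Proof.
  destruct H as [Hn [Ha _]].
  rewrite (Ha (const_C HX 1) (const_C HX c) (c - 1)).
  - rewrite Hn; [ring|reflexivity].
  - intros x; simpl; ring.
Qed.

Lemma OH_ge_const (HX : is_topology X) nu (H : is_OH nu) (c : R) (f : C X) :
  (forall x, c <= cf f x) -> c <= nu f.
Proof.
  intros Hf. rewrite <- (OH_const HX nu H c). apply H. exact Hf.
Qed.

Lemma OH_le_const (HX : is_topology X) nu (H : is_OH nu) (c : R) (f : C X) :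
  (forall x, cf f x <= c) -> nu f <= c.
Proof.
  intros Hf. rewrite <- (OH_const HX nu H c). apply H. exact Hf.
Qed.

Lemma max_is_OH (mu nu : C X -> R) :
  is_OH mu -> is_OH nu -> is_OH (fun f => Rmax (mu f) (nu f)).
Proof.
  intros [Hn [Ha [Ho Hh]]] [Hn' [Ha' [Ho' Hh']]]. repeat split.
  - intros f E. rewrite Hn, Hn' by exact E. apply Rmax_left, Rle_refl.
  - intros f g c E. rewrite (Ha f g c E), (Ha' f g c E).
    unfold Rmax; destruct (Rle_dec (mu f + c) (nu f + c)), (Rle_dec (mu f) (nu f)); lra.
  - intros f g E. apply Rmax_case.
    + eapply Rle_trans; [apply (Ho f g E)|apply Rmax_l].
    + eapply Rle_trans; [apply (Ho' f g E)|apply Rmax_r].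
  - intros f g t Ht E. rewrite (Hh f g t Ht E), (Hh' f g t Ht E).
    apply RmaxRmult; exact Ht.
Qed.

Lemma min_is_OH (mu nu : C X -> R) :
  is_OH mu -> is_OH nu -> is_OH (fun f => Rmin (mu f) (nu f)).
Proof.
  intros [Hn [Ha [Ho Hh]]] [Hn' [Ha' [Ho' Hh']]]. repeat split.
  - intros f E. rewrite Hn, Hn' by exact E. apply Rmin_left, Rle_refl.
  - intros f g c E. rewrite (Ha f g c E), (Ha' f g c E).
    unfold Rmin; destruct (Rle_dec (mu f + c) (nu f + c)), (Rle_dec (mu f) (nu f)); lra.
  - intros f g E. apply Rmin_glb.
    + eapply Rle_trans; [apply Rmin_l|apply (Ho f g E)].
    + eapply Rle_trans; [apply Rmin_r|apply (Ho' f g E)].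
  - intros f g t Ht E. rewrite (Hh f g t Ht E), (Hh' f g t Ht E).
    unfold Rmin; destruct (Rle_dec (t * mu f) (t * nu f)), (Rle_dec (mu f) (nu f));
      nra.
Qed.

(** The conjugate functional [f |-> - nu (- f)]. Here and below [affine_C HX (-1) 0] serves as
    negation of functions. *)
Definition dual (HX : is_topology X) nu (f : C X) : R :=
  - nu (affine_C HX (-1) 0 f).

Lemma dual_is_OH (HX : is_topology X) nu : is_OH nu -> is_OH (dual HX nu).
Proof.
  intros H. unfold dual. repeat split.
  - intros f E. rewrite (OH_ext nu H _ (const_C HX (-1))).
    + rewrite OH_const by exact H. ring.
    + intros x; simpl; rewrite E; ring.
  - intros f g c E.
    rewrite (OH_affine HX nu H 1 (-c) (affine_C HX (-1) 0 f) (affine_C HX (-1) 0 g)).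
    + ring.
    + lra.
    + intros x; simpl; rewrite E; ring.
  - intros f g E. apply Ropp_le_contravar. apply H.
    intros x; simpl; specialize (E x); lra.
  - intros f g t Ht E.
    rewrite (OH_affine HX nu H t 0 (affine_C HX (-1) 0 f) (affine_C HX (-1) 0 g)).
    + ring.
    + exact Ht.
    + intros x; simpl; rewrite E; ring.
Qed.

Lemma dual_dual (HX : is_topology X) nu (H : is_OH nu) (f : C X) :
  dual HX (dual HX nu) f = nu f.
Proof.
  unfold dual. rewrite Ropp_involutive. apply OH_ext; [exact H|].
  intros x; simpl; ring.
Qed.

Lemma OH_eq (mu nu : OH_carrier X) : (forall f, ev mu f = ev nu f) -> mu = nu.
Proof.
  destruct mu as [mu Hmu], nu as [nu Hnu]; simpl; intros E.
  assert (mu = nu) by (apply functional_extensionality; exact E). subst nu.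
  f_equal. apply proof_irrelevance.
Qed.

Lemma ev_affine (HX : is_topology X) (nu : OH_carrier X) (t c : R) (f : C X) :
  0 <= t -> ev nu (affine_C HX t c f) = t * ev nu f + c.
Proof. intros Ht. now apply (OH_affine HX); [exact (proj2_sig nu)|..]. Qed.

Lemma ev_const (HX : is_topology X) (nu : OH_carrier X) (c : R) :
  ev nu (const_C HX c) = c.
Proof. apply OH_const. exact (proj2_sig nu). Qed.

Lemma dirac_is_OH (x : X) : is_OH (fun f : C X => cf f x).
Proof. repeat split; red; auto. Qed.

Definition dirac (x : X) : OH_carrier X := exist _ _ (dirac_is_OH x).

(** [E f a] reads as a certificate that the value at [f] must be at least [a]. Closure of the
    certificates under monotonicity, shifts and positive scalings passes to suprema; the two
    conditions on constants, with boundedness of [f], make the suprema exist and normalize them.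
    Both the perturbed functionals and the least lift arise this way. *)
Lemma sup_is_OH (Hc : is_compact X) (E : C X -> R -> Prop)
  (E_const_le : forall f c, (forall x, c <= cf f x) -> E f c)
  (E_le_const : forall f a c, E f a -> (forall x, cf f x <= c) -> a <= c)
  (E_mono : forall f g a, (forall x, cf f x <= cf g x) -> E f a -> E g a)
  (E_shift : forall f g a c, (forall x, cf g x = cf f x + c) -> E f a -> E g (a + c))
  (E_scale : forall f g a t, 0 < t -> (forall x, cf g x = t * cf f x) ->
     E f a -> E g (t * a)) :
  exists nu : OH_carrier X, forall f, is_lub (E f) (ev nu f).
Proof.
  assert (Hb : forall f, bound (E f)).
  { intros f. destruct (compact_C_bounded X Hc f) as [M HM].
    exists M. intros a Ha. apply (E_le_const f a M Ha). intros x. apply HM. }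
  assert (Hne : forall f, exists a, E f a).
  { intros f. destruct (compact_C_bounded X Hc f) as [M HM].
    exists (- M). apply E_const_le. intros x. apply HM. }
  pose (nu := fun f => proj1_sig (completeness (E f) (Hb f) (Hne f))).
  assert (Hlub : forall f, is_lub (E f) (nu f))
    by (intros f; exact (proj2_sig (completeness (E f) (Hb f) (Hne f)))).
  assert (Hcst : forall f c, (forall x, cf f x = c) -> nu f = c).
  { intros f c Hf. apply Rle_antisym.
    - apply Hlub. intros a Ha. apply (E_le_const f a c Ha).
      intros x; rewrite Hf; apply Rle_refl.
    - apply Hlub. apply E_const_le. intros x; rewrite Hf; apply Rle_refl. }
  (* For shifts and scalings one inequality is enough: applied to the inverse operation it yields
     the other. *)
  assert (Hshift : forall f g c, (forall x, cf g x = cf f x + c) -> nu f + c <= nu g).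
  { intros f g c Hfg. enough (nu f <= nu g - c) by lra.
    apply Hlub. intros a Ha. enough (a + c <= nu g) by lra.
    apply Hlub. apply (E_shift f); assumption. }
  assert (Hscale : forall f g t, 0 < t -> (forall x, cf g x = t * cf f x) ->
            t * nu f <= nu g).
  { intros f g t Ht Hfg. apply (Rmult_le_reg_l (/ t)).
    - apply Rinv_0_lt_compat; exact Ht.
    - rewrite <- Rmult_assoc, Rinv_l, Rmult_1_l by lra.
      apply Hlub. intros a Ha. apply (Rmult_le_reg_l t); [exact Ht|].
      rewrite <- Rmult_assoc, Rinv_r, Rmult_1_l by lra.
      apply Hlub. apply (E_scale f); assumption. }
  assert (Hnu : is_OH nu).
  { repeat split.
    - intros f Hf. apply Hcst; exact Hf.
    - intros f g c Hfg. apply Rle_antisym; [|apply Hshift; exact Hfg].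
      enough (nu g + - c <= nu f) by lra.
      apply Hshift. intros x; rewrite Hfg; ring.
    - intros f g Hfg. apply Hlub. intros a Ha. apply Hlub.
      apply (E_mono f); assumption.
    - intros f g t [Ht|<-] Hfg.
      + apply Rle_antisym; [|apply Hscale; assumption].
        assert (Hi : / t * nu g <= nu f).
        { apply Hscale; [apply Rinv_0_lt_compat; exact Ht|].
          intros x; rewrite Hfg. field. lra. }
        apply (Rmult_le_compat_l t) in Hi; [|lra].
        rewrite <- Rmult_assoc, Rinv_r, Rmult_1_l in Hi by lra. exact Hi.
      (* At [t = 0] the function [g] is the constant 0, so the rule for constants takes over. *)
      + rewrite Rmult_0_l. apply Hcst. intros x; rewrite Hfg; ring. }
  exists (exist _ nu Hnu). exact Hlub.
Qed.

End Functionals.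

(** * The space [OH X] is compact *)

Lemma OH_is_topology (X : Space) : is_topology (OH X).
Proof.
  split; [|split].
  - intros nu _. exists nil, 1. split; [lra|]. intros; exact I.
  - intros U V HU HV nu [HUn HVn].
    destruct (HU nu HUn) as [l1 [e1 [He1 H1]]].
    destruct (HV nu HVn) as [l2 [e2 [He2 H2]]].
    exists (l1 ++ l2), (Rmin e1 e2). split; [apply Rmin_pos; assumption|].
    intros lam Hl. split.
    + apply H1. intros phi Hp. eapply Rlt_le_trans; [|apply Rmin_l].
      apply Hl, in_or_app; left; exact Hp.
    + apply H2. intros phi Hp. eapply Rlt_le_trans; [|apply Rmin_r].
      apply Hl, in_or_app; right; exact Hp.
  - intros J U HU nu [i Hi]. destruct (HU i nu Hi) as [l [e [He H]]].
    exists l, e. split; [exact He|]. intros lam Hl. exists i. apply H; exact Hl.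
Qed.

(** Zorn's lemma enters here, through the ultrafilter lemma of mathcomp, restated for plain
    predicates. *)
Lemma ultrafilter_extension (T : Type) (B : (T -> Prop) -> Prop)
  (B_true : B (fun _ => True))
  (B_and : forall P Q, B P -> B Q -> B (fun x => P x /\ Q x))
  (B_mono : forall P Q : T -> Prop, (forall x, P x -> Q x) -> B P -> B Q)
  (B_inhabited : forall P, B P -> exists x, P x) :
  exists F : (T -> Prop) -> Prop,
    (forall P, B P -> F P) /\
    F (fun _ => True) /\
    (forall P Q, F P -> F Q -> F (fun x => P x /\ Q x)) /\
    (forall P Q : T -> Prop, (forall x, P x -> Q x) -> F P -> F Q) /\
    (forall P, F P -> exists x, P x) /\
    (forall P, F P \/ F (fun x => ~ P x)).
Proof.
  assert (HB : filter.ProperFilter B).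
  { constructor.
    - intros H. destruct (B_inhabited _ H) as [x Hx]. exact Hx.
    - constructor; [exact B_true|exact B_and|exact B_mono]. }
  destruct (filter.ultraFilterLemma HB) as [F [HF HBF]].
  pose proof (filter.ultra_proper (UltraFilter := HF)) as [Hne [HT Hand Hmono]].
  exists F. split; [exact HBF|]. split; [exact HT|]. split; [exact Hand|].
  split; [exact Hmono|]. split.
  - intros P HP. apply NNPP. intros Hn. apply Hne. apply (Hmono P); [|exact HP].
    intros x Hx. exact (Hn (ex_intro _ x Hx)).
  - intros P. exact (filter.in_ultra_setVsetC P HF).
Qed.

(** Without a finite subcover, the complements of finite unions generate a proper filter. An
    ultrafilter [F] above it converges at every [f], the pointwise limit is again in [OH X], and the
    [U i] containing this limit is [F]-large, although its complement is too. *)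
Lemma OH_is_compact (X : Space) (HX : is_topology X) (Hc : is_compact X) : is_compact (OH X).
Proof.
  intros J U HU Hcov. apply NNPP. intros Hfin.
  assert (Hmiss : forall l : list J, exists lam : OH_carrier X,
            forall i, In i l -> ~ U i lam).
  { intros l. apply NNPP. intros Hn. apply Hfin. exists l. intros lam.
    apply NNPP. intros Hl. apply Hn. exists lam. intros i Hi Hu.
    apply Hl. exists i. split; assumption. }
  destruct (ultrafilter_extension (OH_carrier X)
    (fun P => exists l : list J, forall lam, (forall i, In i l -> ~ U i lam) -> P lam))
    as [F [FB [FT [Fand [Fmono [Fne Fultra]]]]]].
  - exists nil. intros; exact I.
  - intros P Q [l1 H1] [l2 H2]. exists (l1 ++ l2). intros lam Hl. split.
    + apply H1. intros i Hi. apply Hl, in_or_app; left; exact Hi.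
    + apply H2. intros i Hi. apply Hl, in_or_app; right; exact Hi.
  - intros P Q HPQ [l Hl]. exists l. intros lam H. apply HPQ, Hl, H.
  - intros P [l Hl]. destruct (Hmiss l) as [lam H]. exists lam. apply Hl, H.
  (* The limit at [f] is the supremum of those [r] for which [r <= ev lam f] holds on an [F]-large
     set; the ultrafilter alternative provides the upper estimate. *)
  - assert (Hlim : forall f : C X, {s : R | forall e, 0 < e ->
              F (fun lam => Rabs (ev lam f - s) < e)}).
    { intros f.
      assert (HM : exists M, forall lam : OH_carrier X, - M <= ev lam f <= M).
      { destruct (compact_C_bounded X Hc f) as [M HM]. exists M. intros lam. split.
        - apply (OH_ge_const HX _ (proj2_sig lam)). intros x. apply HM.
        - apply (OH_le_const HX _ (proj2_sig lam)). intros x. apply HM. }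
      assert (Hbd : bound (fun r => F (fun lam => r <= ev lam f))).
      { destruct HM as [M HM]. exists M. intros r Hr.
        destruct (Fne _ Hr) as [lam Hlam]. specialize (HM lam). lra. }
      assert (Hne : exists r, F (fun lam => r <= ev lam f)).
      { destruct HM as [M HM]. exists (- M). apply (Fmono (fun _ => True)); [|exact FT].
        intros lam _. apply HM. }
      destruct (completeness _ Hbd Hne) as [s [Hub Hleast]].
      exists s. intros e He.
      assert (Hlow : F (fun lam => s - e < ev lam f)).
      { destruct (classic (exists r, F (fun lam => r <= ev lam f) /\ s - e < r))
          as [[r [Hr Hs]]|Hn].
        - apply (Fmono (fun lam => r <= ev lam f)); [intros lam; lra|exact Hr].
        - exfalso. enough (s <= s - e) by lra. apply Hleast. intros r Hr.
          apply Rnot_lt_le. intros Hlt. apply Hn. exists r. split; assumption. }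
      assert (Hupp : F (fun lam => ev lam f < s + e)).
      { destruct (Fultra (fun lam => s + e <= ev lam f)) as [H|H].
        - apply Hub in H. exfalso; lra.
        - revert H. apply Fmono. intros lam H. lra. }
      generalize (Fand _ _ Hlow Hupp). apply Fmono.
      intros lam [H1 H2]. apply Rabs_def1; lra. }
    pose (lim := fun f => proj1_sig (Hlim f)).
    assert (Flim : forall f e, 0 < e -> F (fun lam => Rabs (ev lam f - lim f) < e))
      by (intros f; exact (proj2_sig (Hlim f))).
    assert (Hnear : forall f g e, 0 < e -> exists lam : OH_carrier X,
              Rabs (ev lam f - lim f) < e /\ Rabs (ev lam g - lim g) < e).
    { intros f g e He. exact (Fne _ (Fand _ _ (Flim f e He) (Flim g e He))). }
    (* Each axiom of [OH] amounts to inequalities that are affine in at most two values of the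
       functional, and these survive the limit. *)
    assert (Hlin : forall f g a b c,
              (forall lam : OH_carrier X, a * ev lam f + b * ev lam g + c <= 0) ->
              a * lim f + b * lim g + c <= 0).
    { intros f g a b c H. apply Rnot_lt_le. intros Hlt.
      pose (d := a * lim f + b * lim g + c).
      pose proof (Rabs_pos a) as Ha. pose proof (Rabs_pos b) as Hb.
      (* Errors below [e] in both values change the affine form by at most [(|a| + |b|) * e < d]. *)
      pose (e := d / (1 + Rabs a + Rabs b)).
      assert (He : 0 < e) by (apply Rdiv_lt_0_compat; unfold d; lra).
      assert (Ed : e + Rabs a * e + Rabs b * e = d) by (unfold e; field; lra).
      destruct (Hnear f g e He) as [lam [H1 H2]]. specialize (H lam).
      assert (Hmul : forall u v, Rabs v < e -> - (Rabs u * e) <= u * v).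
      { intros u v Hv. pose proof (Rle_abs (- (u * v))) as Huv.
        rewrite Rabs_Ropp, Rabs_mult in Huv.
        pose proof (Rmult_le_compat_l (Rabs u) _ _ (Rabs_pos u) (Rlt_le _ _ Hv)). lra. }
      apply (Hmul a) in H1. apply (Hmul b) in H2. unfold d in *. lra. }
    assert (Hlam : is_OH lim).
    { repeat split.
      - intros f Hf.
        assert (Ef : forall lam : OH_carrier X, ev lam f = 1)
          by (intros [lam Hlam]; apply Hlam; exact Hf).
        apply Rle_antisym.
        + enough (1 * lim f + 0 * lim f + -1 <= 0) by lra.
          apply Hlin. intros lam; rewrite Ef; lra.
        + enough (-1 * lim f + 0 * lim f + 1 <= 0) by lra.
          apply Hlin. intros lam; rewrite Ef; lra.
      - intros f g c Hfg.
        assert (Ef : forall lam : OH_carrier X, ev lam g = ev lam f + c)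
          by (intros [lam Hlam]; apply Hlam; exact Hfg).
        apply Rle_antisym.
        + enough (-1 * lim f + 1 * lim g + - c <= 0) by lra.
          apply Hlin. intros lam; rewrite Ef; lra.
        + enough (1 * lim f + -1 * lim g + c <= 0) by lra.
          apply Hlin. intros lam; rewrite Ef; lra.
      - intros f g Hfg. enough (1 * lim f + -1 * lim g + 0 <= 0) by lra.
        apply Hlin. intros [lam Hlam]. simpl.
        assert (lam f <= lam g) by (apply Hlam; exact Hfg). lra.
      - intros f g t Ht Hfg.
        assert (Ef : forall lam : OH_carrier X, ev lam g = t * ev lam f)
          by (intros [lam Hlam]; apply Hlam; assumption).
        apply Rle_antisym.
        + enough (- t * lim f + 1 * lim g + 0 <= 0) by lra.
          apply Hlin. intros lam; rewrite Ef; lra.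
        + enough (t * lim f + -1 * lim g + 0 <= 0) by lra.
          apply Hlin. intros lam; rewrite Ef; lra. }
    pose (Lam := exist _ lim Hlam : OH_carrier X).
    destruct (Hcov Lam) as [i Hi]. destruct (HU i Lam Hi) as [l [e [He Hl]]].
    assert (Fl : F (fun lam => forall f, In f l -> Rabs (ev lam f - lim f) < e)).
    { clear Hl. induction l as [|g l IH].
      - revert FT. apply Fmono. intros lam _ f [].
      - generalize (Fand _ _ (Flim g e He) IH). apply Fmono.
        intros lam [Hg H] f [<-|Hf]; [exact Hg|apply H; exact Hf]. }
    assert (FnU : F (fun lam => ~ U i lam)).
    { apply FB. exists (i :: nil). intros lam H. apply H. left; reflexivity. }
    destruct (Fne _ (Fand _ _ Fl FnU)) as [lam [H1 H2]].
    apply H2, Hl, H1.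
Qed.

(** * Finite families of minorants *)

(* [lam'] is the least functional in [OH X] whose value at each [f] of [l] is at
   least [lam f - d]. *)
Lemma lower_perturbation (X : Space) (HX : is_topology X) (Hc : is_compact X)
  (lam : OH_carrier X) (l : list (C X)) (d : R) (Hd : 0 < d) :
  exists lam' : OH_carrier X,
    (forall f, In f l -> Rabs (ev lam' f - ev lam f) <= d) /\
    (forall phi a, a < ev lam' phi ->
       (forall x, a <= cf phi x) \/
       exists t f, 0 <= t /\ In f l /\
         forall x, t * (cf f x - ev lam f + d) + a <= cf phi x).
Proof.
  (* A functional with value at least [lam f - d] at [f] is at least [a] at
     [t * (f - lam f + d) + a], hence at anything above it; [E] records these forced bounds and
     those from constants. *)
  pose (E := fun (phi : C X) a => (forall x, a <= cf phi x) \/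
    exists t f, 0 <= t /\ In f l /\
      forall x, t * (cf f x - ev lam f + d) + a <= cf phi x).
  assert (Hlam := proj2_sig lam).
  (* [lam] itself satisfies the constraints. This bounds the certificates and gives
     [lam' <= lam]. *)
  assert (HE : forall phi a, E phi a -> a <= ev lam phi).
  { intros phi a [H|[t [f [Ht [_ H]]]]]; [exact (OH_ge_const HX _ Hlam a phi H)|].
    apply Rle_trans with (ev lam (affine_C HX t (t * (d - ev lam f) + a) f)).
    - rewrite ev_affine by exact Ht.
      pose proof (Rmult_le_pos t d Ht (Rlt_le _ _ Hd)). lra.
    - apply Hlam. intros x; simpl. specialize (H x). lra. }
  destruct (sup_is_OH Hc E) as [lam' Hlub].
  - intros f c H; left; exact H.
  - intros f a c Ha Hf. apply Rle_trans with (ev lam f); [exact (HE f a Ha)|].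
    exact (OH_le_const HX _ Hlam c f Hf).
  - intros f g a Hfg [H|[t [h [Ht [Hh H]]]]].
    + left. intros x. eapply Rle_trans; [apply H|apply Hfg].
    + right. exists t, h. split; [exact Ht|]. split; [exact Hh|].
      intros x. eapply Rle_trans; [apply H|apply Hfg].
  - intros f g a c Hfg [H|[t [h [Ht [Hh H]]]]].
    + left. intros x. rewrite Hfg. specialize (H x). lra.
    + right. exists t, h. split; [exact Ht|]. split; [exact Hh|].
      intros x. rewrite Hfg. specialize (H x). lra.
  - intros f g a s Hs Hfg [H|[t [h [Ht [Hh H]]]]].
    + left. intros x. rewrite Hfg. apply Rmult_le_compat_l; [lra|apply H].
    + right. exists (s * t), h. split; [apply Rmult_le_pos; lra|].
      split; [exact Hh|]. intros x. rewrite Hfg.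
      rewrite Rmult_assoc, <- Rmult_plus_distr_l.
      apply Rmult_le_compat_l; [lra|apply H].
  - exists lam'. split.
    + intros f Hf. apply Rabs_le. split.
      * enough (ev lam f - d <= ev lam' f) by lra. apply Hlub. right.
        exists 1, f. split; [lra|]. split; [exact Hf|]. intros x; lra.
      * enough (ev lam' f <= ev lam f) by lra. apply Hlub. intros a; apply HE.
    + intros phi a Ha.
      destruct (classic (exists b, E phi b /\ a < b)) as [[b [Hb Hab]]|Hn].
      * destruct Hb as [H|[t [f [Ht [Hf H]]]]].
        -- left. intros x. specialize (H x). lra.
        -- right. exists t, f. split; [exact Ht|]. split; [exact Hf|].
           intros x. specialize (H x). lra.
      * exfalso. enough (ev lam' phi <= a) by lra. apply Hlub. intros b Hb.
        apply Rnot_lt_le. intros Hab. apply Hn. exists b. split; assumption.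
Qed.

(** The nodes serve as slopes of affine functions, and [ev] commutes with [affine_C] for nonnegative
    slopes; hence the sign condition. *)
Lemma interval_net (T eta : R) (Heta : 0 < eta) :
  exists ts : list R, (forall s, In s ts -> 0 <= s) /\
    forall t, 0 <= t <= T -> exists s, In s ts /\ Rabs (t - s) <= eta.
Proof.
  assert (Hn : forall n, exists ts : list R, (forall s, In s ts -> 0 <= s) /\
    forall t, 0 <= t <= INR n * eta -> exists s, In s ts /\ Rabs (t - s) <= eta).
  { induction n as [|n [ts [Hpos IH]]].
    - exists (0 :: nil). split.
      + intros s [<-|[]]; lra.
      + intros t Ht. simpl in Ht. exists 0. split; [left; reflexivity|].
        apply Rabs_le; lra.
    - exists (INR n * eta :: ts). split.
      + intros s [<-|Hs]; [|apply Hpos; exact Hs].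
        apply Rmult_le_pos; [apply pos_INR|lra].
      + intros t Ht. rewrite S_INR in Ht.
        destruct (Rle_dec t (INR n * eta)) as [H|H].
        * destruct (IH t) as [s [Hs Hts]]; [lra|].
          exists s. split; [right; exact Hs|exact Hts].
        * exists (INR n * eta). split; [left; reflexivity|]. apply Rabs_le; lra. }
  destruct (INR_unbounded (T / eta)) as [n Hlt].
  destruct (Hn n) as [ts [Hpos Hts]]. exists ts. split; [exact Hpos|].
  intros t Ht. apply Hts. split; [apply Ht|].
  apply (Rmult_lt_compat_r eta) in Hlt; [|exact Heta].
  unfold Rdiv in Hlt. rewrite Rmult_assoc, Rinv_l in Hlt; lra.
Qed.

(* Where lowering the slope to [T] raises the line, i.e. for [g + d < 0], the
   bound [m <= y] already suffices. *)
Lemma slope_truncation (T d m c t g y : R) :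
  0 <= T -> 0 <= t -> 0 <= d -> c - m <= T * d -> m <= y ->
  t * (g + d) + c <= y -> Rmin t T * g + c <= y.
Proof.
  intros HT Ht Hd HTd Hm H. apply Rmin_case_strong; intros Hle.
  - pose proof (Rmult_le_pos t d Ht Hd). lra.
  - destruct (Rle_dec 0 (g + d)) as [Hg|Hg].
    + pose proof (Rmult_le_compat_r (g + d) T t Hg Hle).
      pose proof (Rmult_le_pos T d HT Hd). lra.
    + assert (T * (g + d) <= T * 0) by (apply Rmult_le_compat_l; lra). lra.
Qed.

Lemma local_minorants (X : Space) (HX : is_topology X) (Hc : is_compact X)
  (Phi : C (OH X)) (eps : R) (Heps : 0 < eps) (lam : OH_carrier X) :
  exists (S : list (C X)) (O : OH X -> Prop),
    is_open (OH X) O /\ O lam /\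
    (forall h lam', In h S -> O lam' -> cf Phi lam' - eps <= ev lam' h) /\
    (forall phi, (forall lam', cf Phi lam' <= ev lam' phi) ->
       exists h, In h S /\ forall x, cf h x <= cf phi x).
Proof.
  assert (Hlam := proj2_sig lam).
  destruct (compact_C_bounded _ (OH_is_compact X HX Hc) Phi) as [M HM].
  (* Four errors of size [e]: the gap between [c] and [Phi lam], the discretized slope, the
     variation of [Phi] on [near], and the variation of [h] on [close]. *)
  pose (e := eps / 4). assert (He : 0 < e) by (unfold e; lra).
  pose (near := fun lam' : OH X => Rabs (cf Phi lam' - cf Phi lam) < e).
  assert (Onear : is_open (OH X) near)
    by (apply (proj2_sig Phi (fun r => Rabs (r - cf Phi lam) < e)), open_set_ball).
  assert (near_lam : near lam)
    by (unfold near; rewrite Rminus_diag, Rabs_R0; exact He).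
  destruct (Onear lam near_lam) as [l [d0 [Hd0 Hl]]].
  (* The perturbation moves values by at most [d], while the basic neighbourhood asks for strictly
     less than [d0]. *)
  pose (d := d0 / 2). assert (Hd : 0 < d) by (unfold d; lra).
  destruct (lower_perturbation X HX Hc lam l d Hd) as [lam1 [Hnear Hlam1]].
  assert (HPhi1 : near lam1).
  { apply Hl. intros f Hf. specialize (Hnear f Hf). unfold d in Hnear. lra. }
  (* Since [lam1] is in [near], [c < Phi lam1 <= lam1 phi] for every admissible [phi], so the
     dichotomy for [lam1] applies at level [c]. *)
  pose (c := cf Phi lam - e).
  (* The slope bound that truncation requires when [phi] is bounded below by [- M]. *)
  pose (T := Rmax 0 ((c + M) / d)).
  assert (HT : 0 <= T) by apply Rmax_l.
  assert (HTd : c - - M <= T * d).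
  { assert (H : (c + M) / d <= T) by apply Rmax_r.
    apply (Rmult_le_compat_r d) in H; [|lra].
    unfold Rdiv in H. rewrite Rmult_assoc, Rinv_l in H; lra. }
  (* With this uniform bound, changing a slope by at most [e / G] costs at most [e]. *)
  assert (HG : exists G, 0 < G /\ forall f, In f l -> forall x,
            Rabs (cf f x - ev lam f) <= G).
  { clear - Hc. induction l as [|g l [G [HG IH]]].
    - exists 1. split; [lra|]. intros f [].
    - destruct (compact_C_bounded X Hc g) as [Mg HMg].
      exists (Rmax G (Mg + Rabs (ev lam g))). split.
      + eapply Rlt_le_trans; [exact HG|apply Rmax_l].
      + intros f [<-|Hf] x.
        * eapply Rle_trans; [|apply Rmax_r]. unfold Rminus.
          eapply Rle_trans; [apply Rabs_triang|]. rewrite Rabs_Ropp.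
          apply Rplus_le_compat_r, Rabs_le, HMg.
        * eapply Rle_trans; [apply (IH f Hf)|apply Rmax_l]. }
  destruct HG as [G [HG0 HG]].
  destruct (interval_net T (e / G)) as [ts [Hts0 Hts]];
    [apply Rdiv_lt_0_compat; assumption|].
  (* The lines take the value [c - e] at [lam]; the extra [e] absorbs the rounding of the slope. The
     constant [c] answers the first alternative of the dichotomy. *)
  pose (S := const_C HX c ::
    flat_map (fun f => map (fun s => affine_C HX s (c - e - s * ev lam f) f) ts) l).
  assert (HSlam : forall h, In h S -> cf Phi lam - 2 * e <= ev lam h).
  { intros h [<-|Hh].
    - rewrite ev_const. unfold c. lra.
    - apply in_flat_map in Hh. destruct Hh as [f [Hf Hh]].
      apply in_map_iff in Hh. destruct Hh as [s [<- Hs]].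
      rewrite ev_affine by (apply Hts0; exact Hs). unfold c. lra. }
  pose (close := fun lam' : OH X =>
    forall h, In h S -> Rabs (ev lam' h - ev lam h) < e).
  exists S, (fun lam' => near lam' /\ close lam'). split; [|split; [|split]].
  - apply (proj1 (proj2 (OH_is_topology X))); [exact Onear|].
    unfold close. generalize S. intros S0.
    induction S0 as [|h S0 IH].
    + eapply is_open_ext; [|apply (proj1 (OH_is_topology X))].
      intros lam'. split; [intros _ h []|intros _; exact I].
    + eapply is_open_ext; [|apply (proj1 (proj2 (OH_is_topology X)));
        [apply (pi_continuous X h (fun r => Rabs (r - ev lam h) < e)), open_set_ball
        |exact IH]].
      intros lam'. split.
      * intros [H1 H2] g [<-|Hg]; [exact H1|apply H2; exact Hg].
      * intros H. split; [apply H; left; reflexivity|].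
        intros g Hg. apply H; right; exact Hg.
  - split; [exact near_lam|]. intros h _. rewrite Rminus_diag, Rabs_R0. exact He.
  - intros h lam' Hh [H1 H2]. specialize (H2 h Hh). specialize (HSlam h Hh).
    unfold near in H1. apply Rabs_def2 in H1. apply Rabs_def2 in H2.
    unfold e in *. lra.
  - intros phi Hphi.
    (* Evaluation at Dirac functionals turns the bound on [Phi] into one on [phi]. *)
    assert (Hphim : forall x, - M <= cf phi x).
    { intros x. eapply Rle_trans; [apply (HM (dirac x))|]. apply (Hphi (dirac x)). }
    destruct (Hlam1 phi c) as [H|[t [f [Ht [Hf H]]]]].
    + specialize (Hphi lam1). unfold near in HPhi1. apply Rabs_def2 in HPhi1.
      unfold c. lra.
    + exists (const_C HX c). split; [left; reflexivity|exact H].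
    + destruct (Hts (Rmin t T)) as [s [Hs Hst]].
      { split; [apply Rmin_glb; assumption|apply Rmin_r]. }
      exists (affine_C HX s (c - e - s * ev lam f) f). split.
      * right. apply in_flat_map. exists f. split; [exact Hf|].
        apply in_map_iff. exists s. split; [reflexivity|exact Hs].
      * intros x. simpl.
        assert (Htr := slope_truncation T d (- M) c t (cf f x - ev lam f) (cf phi x)
          HT Ht (Rlt_le _ _ Hd) HTd (Hphim x) (H x)).
        assert (Hdiff : (s - Rmin t T) * (cf f x - ev lam f) <= e).
        { eapply Rle_trans; [apply Rle_abs|]. rewrite Rabs_mult.
          replace e with (e / G * G) by (field; lra).
          rewrite Rabs_minus_sym in Hst.
          apply Rmult_le_compat; try apply Rabs_pos; [exact Hst|exact (HG f Hf x)]. }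
        lra.
Qed.

(** Finitely many local families cover [OH X]. A maximum of one member from each satisfies every
    local lower bound, and [phi] dominates it once it dominates the chosen members. *)
Lemma finite_minorants (X : Space) (HX : is_topology X) (Hc : is_compact X)
  (Phi : C (OH X)) (eps : R) (Heps : 0 < eps) :
  exists S : list (C X),
    (forall psi lam, In psi S -> cf Phi lam - eps <= ev lam psi) /\
    (forall phi, (forall lam, cf Phi lam <= ev lam phi) ->
       exists psi, In psi S /\ forall x, cf psi x <= cf phi x).
Proof.
  pose (good := fun p : list (C X) * (OH X -> Prop) => is_open (OH X) (snd p) /\
    (forall h lam', In h (fst p) -> snd p lam' -> cf Phi lam' - eps <= ev lam' h) /\
    (forall phi, (forall lam', cf Phi lam' <= ev lam' phi) ->
       exists h, In h (fst p) /\ forall x, cf h x <= cf phi x)).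
  destruct (OH_is_compact X HX Hc {p | good p} (fun i => snd (proj1_sig i)))
    as [l Hl].
  - intros [p Hp]. apply Hp.
  - intros lam.
    destruct (local_minorants X HX Hc Phi eps Heps lam) as [S [O [H1 [H2 [H3 H4]]]]].
    assert (Hp : good (S, O)) by (repeat split; assumption).
    exists (exist _ (S, O) Hp). exact H2.
  (* Restricting the lower bound to the sets in [l] makes induction on [l] possible; the covering
     property is used only afterwards. *)
  - enough (H : exists S : list (C X),
      (forall psi i lam, In psi S -> In i l -> snd (proj1_sig i) lam ->
         cf Phi lam - eps <= ev lam psi) /\
      (forall phi, (forall lam, cf Phi lam <= ev lam phi) ->
         exists psi, In psi S /\ forall x, cf psi x <= cf phi x)).
    { destruct H as [S [H1 H2]]. exists S. split; [|exact H2].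
      intros psi lam Hpsi. destruct (Hl lam) as [i [Hi Hlam]].
      exact (H1 psi i lam Hpsi Hi Hlam). }
    clear Hl. induction l as [|[[S0 O] [HO [Hlow Hdom]]] l [S [H1 H2]]].
    (* For the empty list one function below every admissible [phi] is required: a constant lower
       bound of [Phi]. *)
    + destruct (compact_C_bounded _ (OH_is_compact X HX Hc) Phi) as [M HM].
      exists (const_C HX (- M) :: nil). split; [intros psi i lam _ []|].
      intros phi Hphi. exists (const_C HX (- M)). split; [left; reflexivity|].
      intros x. simpl. eapply Rle_trans; [apply (HM (dirac x))|apply (Hphi (dirac x))].
    + exists (flat_map (fun psi => map (max_C HX psi) S0) S). split.
      * intros psi i lam Hpsi Hi Hlam.
        apply in_flat_map in Hpsi. destruct Hpsi as [f [Hf Hpsi]].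
        apply in_map_iff in Hpsi. destruct Hpsi as [h [<- Hh]].
        destruct Hi as [<-|Hi].
        -- apply Rle_trans with (ev lam h); [exact (Hlow h lam Hh Hlam)|].
           apply (proj2_sig lam). intros x. apply Rmax_r.
        -- apply Rle_trans with (ev lam f); [exact (H1 f i lam Hf Hi Hlam)|].
           apply (proj2_sig lam). intros x. apply Rmax_l.
      * intros phi Hphi. destruct (H2 phi Hphi) as [f [Hf Hfphi]].
        destruct (Hdom phi Hphi) as [h [Hh Hhphi]].
        exists (max_C HX f h). split.
        -- apply in_flat_map. exists f. split; [exact Hf|].
           apply in_map_iff. exists h. split; [reflexivity|exact Hh].
        -- intros x. apply Rmax_lub; [apply Hfphi|apply Hhphi].
Qed.

(** * Duality *)

Definition dual_OH {X : Space} (HX : is_topology X) (nu : OH_carrier X) :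
  OH_carrier X :=
  exist _ _ (dual_is_OH HX (ev nu) (proj2_sig nu)).

Lemma dual_OH_involutive (X : Space) (HX : is_topology X) (nu : OH_carrier X) :
  dual_OH HX (dual_OH HX nu) = nu.
Proof. apply OH_eq. intros f. apply dual_dual. exact (proj2_sig nu). Qed.

(* [Phi |-> - Phi o dual] reverses the order and maps [pi phi] to [pi (- phi)];
   it exchanges minorants with majorants and [L] with [U]. *)
Lemma conj_continuous (X : Space) (HX : is_topology X) (Phi : C (OH X)) :
  continuous_R (OH X) (fun lam => - cf Phi (dual_OH HX lam)).
Proof.
  intros U HU.
  assert (HU' : open_set (fun r => U (- r))).
  { intros r Hr. destruct (HU _ Hr) as [e He]. exists e. intros s Hs. apply He.
    unfold disc in *. replace (- s - - r) with (- (s - r)) by ring.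
    rewrite Rabs_Ropp. exact Hs. }
  intros lam Hlam.
  destruct (proj2_sig Phi _ HU' (dual_OH HX lam) Hlam) as [l [e [He Hl]]].
  exists (map (affine_C HX (-1) 0) l), e. split; [exact He|].
  intros lam' Hlam'. apply Hl. intros f Hf. simpl. unfold dual.
  rewrite <- Rabs_Ropp.
  replace (- (_ - _)) with (ev lam' (affine_C HX (-1) 0 f) - ev lam (affine_C HX (-1) 0 f))
    by ring.
  apply Hlam', in_map, Hf.
Qed.

Definition conj_C {X : Space} (HX : is_topology X) (Phi : C (OH X)) : C (OH X) :=
  exist _ _ (conj_continuous X HX Phi).

Lemma ev_opp_opp (X : Space) (HX : is_topology X) (lam : OH_carrier X) (phi : C X) :
  ev lam (affine_C HX (-1) 0 (affine_C HX (-1) 0 phi)) = ev lam phi.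
Proof.
  apply OH_ext; [exact (proj2_sig lam)|]. intros x; simpl; ring.
Qed.

(** [dual_OH] is an involution of [OH X], so quantifying over [lam] or over its dual is the same. *)
Lemma le_conj_iff (X : Space) (HX : is_topology X) (Phi : C (OH X)) (phi : C X) (e : R) :
  (forall lam, cf (conj_C HX Phi) lam - e <= ev lam phi) <->
  (forall lam, ev lam (affine_C HX (-1) 0 phi) <= cf Phi lam + e).
Proof.
  split; intros H lam; specialize (H (dual_OH HX lam)); simpl in H; unfold dual in H.
  - rewrite dual_OH_involutive in H. lra.
  - rewrite ev_opp_opp in H. simpl. lra.
Qed.

Lemma conj_le_iff (X : Space) (HX : is_topology X) (Phi : C (OH X)) (phi : C X) :
  (forall lam, ev lam phi <= cf (conj_C HX Phi) lam) <->
  (forall lam, cf Phi lam <= ev lam (affine_C HX (-1) 0 phi)).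
Proof.
  split; intros H lam; specialize (H (dual_OH HX lam)); simpl in H; unfold dual in H.
  - rewrite dual_OH_involutive in H. lra.
  - rewrite ev_opp_opp in H. simpl. lra.
Qed.

Lemma finite_majorants (X : Space) (HX : is_topology X) (Hc : is_compact X)
  (Phi : C (OH X)) (eps : R) (Heps : 0 < eps) :
  exists S : list (C X),
    (forall psi lam, In psi S -> ev lam psi <= cf Phi lam + eps) /\
    (forall phi, (forall lam, ev lam phi <= cf Phi lam) ->
       exists psi, In psi S /\ forall x, cf phi x <= cf psi x).
Proof.
  destruct (finite_minorants X HX Hc (conj_C HX Phi) eps Heps) as [S [H1 H2]].
  exists (map (affine_C HX (-1) 0) S). split.
  - intros psi lam Hpsi. apply in_map_iff in Hpsi. destruct Hpsi as [h [<- Hh]].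
    revert lam. apply le_conj_iff. intros lam. apply H1; exact Hh.
  - intros phi Hphi. destruct (H2 (affine_C HX (-1) 0 phi)) as [h [Hh Hle]].
    (* The exact inequality is the case of error 0. *)
    + intros lam. rewrite <- (Rminus_0_r (cf _ lam)). revert lam. apply le_conj_iff.
      intros lam. rewrite ev_opp_opp. specialize (Hphi lam). lra.
    + exists (affine_C HX (-1) 0 h). split; [apply in_map, Hh|].
      intros x. specialize (Hle x). simpl in *. lra.
Qed.

(** * Extremal lifts *)

(** If [pi phi <= Phi], any functional over [nu] is at least [nu phi] at [Phi]; the supremum of
    these forced values is itself in [OH (OH X)]. *)
Lemma lower_lift (X : Space) (HX : is_topology X) (Hc : is_compact X)
  (nu : OH_carrier X) :
  exists L : OH_carrier (OH X), forall Phi : C (OH X), is_lub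
    (fun a => exists phi, a = ev nu phi /\ forall lam, ev lam phi <= cf Phi lam)
    (ev L Phi).
Proof.
  assert (Hnu := proj2_sig nu).
  apply (sup_is_OH (OH_is_compact X HX Hc) (fun (Phi : C (OH X)) a =>
    exists phi, a = ev nu phi /\ forall lam : OH_carrier X, ev lam phi <= cf Phi lam)).
  - intros Phi c H. exists (const_C HX c). split.
    + symmetry. apply ev_const.
    + intros lam. rewrite ev_const. apply H.
  - intros Phi a c [phi [-> H]] HPhi. apply (OH_le_const HX _ Hnu). intros x.
    apply Rle_trans with (cf Phi (dirac x)); [apply (H (dirac x))|apply HPhi].
  - intros Phi Psi a HPP [phi [-> H]]. exists phi. split; [reflexivity|].
    intros lam. eapply Rle_trans; [apply H|apply HPP].
  - intros Phi Psi a c HPP [phi [-> H]]. exists (affine_C HX 1 c phi).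
    assert (E : forall lam : OH_carrier X, ev lam (affine_C HX 1 c phi) = ev lam phi + c)
      by (intros lam; rewrite ev_affine; lra).
    split; [symmetry; apply E|]. intros lam. rewrite E, HPP. specialize (H lam). lra.
  - intros Phi Psi a t Ht HPP [phi [-> H]]. exists (affine_C HX t 0 phi).
    assert (E : forall lam : OH_carrier X, ev lam (affine_C HX t 0 phi) = t * ev lam phi)
      by (intros lam; rewrite ev_affine; lra).
    split; [symmetry; apply E|]. intros lam. rewrite E, HPP.
    apply Rmult_le_compat_l; [lra|apply H].
Qed.

(** The conjugate of the lower lift of [dual nu]. The two clauses say that [ev U Phi] is the infimum
    of [nu phi] over the majorants [pi phi] of [Phi]. *)
Lemma upper_lift (X : Space) (HX : is_topology X) (Hc : is_compact X)
  (nu : OH_carrier X) :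
  exists U : OH_carrier (OH X), forall Phi : C (OH X),
    (forall phi, (forall lam, cf Phi lam <= ev lam phi) -> ev U Phi <= ev nu phi) /\
    (forall b, (forall phi, (forall lam, cf Phi lam <= ev lam phi) -> b <= ev nu phi) ->
       b <= ev U Phi).
Proof.
  destruct (lower_lift X HX Hc (dual_OH HX nu)) as [L HL].
  destruct (proj2_sig L) as [_ [La [Lo Lh]]]. fold (ev L) in La, Lo, Lh.
  assert (HU : is_OH (fun Phi => - ev L (conj_C HX Phi))).
  { repeat split.
    - intros Phi H.
      rewrite (OH_ext (ev L) (proj2_sig L) _ (const_C (OH_is_topology X) (-1)));
        [|intros lam; simpl; rewrite H; reflexivity].
      rewrite ev_const. ring.
    - intros Phi Psi c H.
      rewrite (La (conj_C HX Phi) (conj_C HX Psi) (- c)); [ring|].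
      intros lam; simpl; rewrite H; ring.
    - intros Phi Psi H. apply Ropp_le_contravar, Lo.
      intros lam; simpl. apply Ropp_le_contravar, H.
    - intros Phi Psi t Ht H.
      rewrite (Lh (conj_C HX Phi) (conj_C HX Psi) t Ht); [ring|].
      intros lam; simpl; rewrite H; ring. }
  exists (exist _ _ HU). intros Phi. simpl. destruct (HL (conj_C HX Phi)) as [Hub Hleast].
  split.
  - intros phi H. enough (- ev nu phi <= ev L (conj_C HX Phi)) by lra.
    apply Hub. exists (affine_C HX (-1) 0 phi). split.
    + simpl. unfold dual. rewrite ev_opp_opp. reflexivity.
    + apply conj_le_iff. intros lam. rewrite ev_opp_opp. apply H.
  - intros b H. enough (ev L (conj_C HX Phi) <= - b) by lra.
    apply Hleast. intros a [psi [-> Hpsi]]. apply Ropp_le_contravar, H.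
    apply conj_le_iff. exact Hpsi.
Qed.

(** [S] is fixed before [nu]. If [pi phi <= Phi], some [psi] in [S] has [phi <= psi] and
    [pi psi <= Phi + e], so [nu phi <= nu psi < N (pi psi) + e <= N Phi + 2 * e]; the other bound is
    symmetric. *)
Lemma fibre_bounds_near (X : Space) (HX : is_topology X) (Hc : is_compact X)
  (N : OH_carrier (OH X)) (l : list (C (OH X))) (e : R) (He : 0 < e) :
  exists S : list (C X), forall nu : OH_carrier X,
    (forall psi, In psi S -> Rabs (ev nu psi - ev N (pi psi)) < e) ->
    forall Phi : C (OH X), In Phi l ->
      (forall phi, (forall lam, ev lam phi <= cf Phi lam) ->
         ev nu phi <= ev N Phi + 2 * e) /\
      (forall phi, (forall lam, cf Phi lam <= ev lam phi) ->
         ev N Phi - 2 * e <= ev nu phi).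
Proof.
  destruct (proj2_sig N) as [_ [Na [No _]]].
  assert (Hev : forall (lam : OH_carrier X) psi c,
            ev lam (affine_C HX 1 c psi) = ev lam psi + c)
    by (intros; rewrite ev_affine; lra).
  assert (Hshift : forall psi c, ev N (pi (affine_C HX 1 c psi)) = ev N (pi psi) + c)
    by (intros psi c; apply Na; intros lam; apply Hev).
  induction l as [|Phi0 l [S IH]].
  - exists nil. intros nu _ Phi [].
  - destruct (finite_majorants X HX Hc Phi0 e He) as [S1 [H1 H1']].
    destruct (finite_minorants X HX Hc Phi0 e He) as [S2 [H2 H2']].
    exists ((S1 ++ S2) ++ S). intros nu Hnu Phi [<-|HPhi].
    + split; intros phi Hphi.
      * destruct (H1' phi Hphi) as [psi [Hpsi Hle]].
        assert (Hclose : Rabs (ev nu psi - ev N (pi psi)) < e).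
        { apply Hnu, in_or_app; left; apply in_or_app; left; exact Hpsi. }
        apply Rabs_def2 in Hclose.
        assert (ev nu phi <= ev nu psi) by (apply (proj2_sig nu); exact Hle).
        assert (ev N (pi (affine_C HX 1 (- e) psi)) <= ev N Phi0).
        { apply No. intros lam. simpl. rewrite Hev. specialize (H1 psi lam Hpsi). lra. }
        rewrite Hshift in *. lra.
      * destruct (H2' phi Hphi) as [psi [Hpsi Hle]].
        assert (Hclose : Rabs (ev nu psi - ev N (pi psi)) < e).
        { apply Hnu, in_or_app; left; apply in_or_app; right; exact Hpsi. }
        apply Rabs_def2 in Hclose.
        assert (ev nu psi <= ev nu phi) by (apply (proj2_sig nu); exact Hle).
        assert (ev N Phi0 <= ev N (pi (affine_C HX 1 e psi))).
        { apply No. intros lam. simpl. rewrite Hev. specialize (H2 psi lam Hpsi). lra. }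
        rewrite Hshift in *. lra.
    + apply IH; [|exact HPhi]. intros psi Hpsi.
      apply Hnu, in_or_app; right; exact Hpsi.
Qed.

Theorem theorem3 (X : Space) (HX : is_topology X) (Hc : is_compact X)
  (Hh : is_hausdorff X) :
  open_map (OH (OH X)) (OH X) (mu_OH X).
Proof.
  intros W HW nu0 [N0 [HN0 <-]].
  destruct (HW N0 HN0) as [l [eps [Heps Hl]]].
  assert (He : 0 < eps / 3) by lra.
  destruct (fibre_bounds_near X HX Hc N0 l (eps / 3) He) as [S HS].
  exists S, (eps / 3). split; [exact He|]. intros nu Hnu.
  destruct (lower_lift X HX Hc nu) as [L HL].
  destruct (upper_lift X HX Hc nu) as [U HU].
  (* [N0] is clamped between the extremal lifts of [nu]. This moves its values on [l] by at most
     [2 * (eps / 3) < eps]. *)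
  pose (N := exist _ _ (max_is_OH _ _ (proj2_sig L)
               (min_is_OH _ _ (proj2_sig N0) (proj2_sig U))) : OH_carrier (OH X)).
  assert (EN : forall Phi, ev N Phi = Rmax (ev L Phi) (Rmin (ev N0 Phi) (ev U Phi)))
    by reflexivity.
  exists N. split.
  - apply Hl. intros Phi HPhi. rewrite EN.
    destruct (HS nu Hnu Phi HPhi) as [Hup Hlow].
    assert (HLPhi : ev L Phi <= ev N0 Phi + 2 * (eps / 3)).
    { apply HL. intros a [phi [-> Hphi]]. apply Hup; exact Hphi. }
    assert (HUPhi : ev N0 Phi - 2 * (eps / 3) <= ev U Phi).
    { apply HU. exact Hlow. }
    unfold Rmax, Rmin. destruct (Rle_dec (ev N0 Phi) (ev U Phi));
      destruct (Rle_dec (ev L Phi) _); apply Rabs_def1; lra.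
  - apply OH_eq. intros phi. change (ev N (pi phi) = ev nu phi). rewrite EN.
    assert (HUphi : ev U (pi phi) <= ev nu phi).
    { apply HU. intros lam. apply Rle_refl. }
    (* At [pi phi] the lower lift equals [nu phi] and the cap by [U] keeps the minimum below it, so
       the clamp returns [nu phi]. *)
    assert (HLphi : ev L (pi phi) = ev nu phi).
    { apply Rle_antisym.
      - apply HL. intros a [psi [-> Hpsi]]. apply (proj2_sig nu).
        intros x. apply (Hpsi (dirac x)).
      - apply HL. exists phi. split; [reflexivity|]. intros lam. apply Rle_refl. }
    rewrite HLphi. apply Rmax_left.
    eapply Rle_trans; [apply Rmin_r|exact HUphi].
Qed.
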